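(* Let $K$ be a field, $Q$ a finite quiver, $\succ$ a length admissible order on the set $\mathcal B$ of paths of $Q$, and $I$ an ideal in $KQ$. The algebra $\Lambda=KQ/I$ is a strong Koszul algebra (with respect to $I$ and $\succ$) if and only if $\Lambda^{op}=KQ^{op}/I^{op}$ is a strong Koszul algebra (with respect to $I^{op}$ and $\succ^{op}$).
   Context: $\Lambda^{op}=\{\lambda^{op}:\lambda\in\Lambda\}$ is the opposite algebra, with $\lambda^{op}\cdot(\lambda')^{op}=(\lambda'\lambda)^{op}$. $Q^{op}$ is the opposite quiver (each arrow $a\colon u\to v$ replaced by $a^{op}\colon v\to u$), and for a path $p=a_1\cdots a_n$ of $Q$, $p^{op}=a_n^{op}\cdots a_1^{op}$, extended linearly to $x\mapsto x^{op}$, $KQ\to KQ^{op}$. $I^{op}=\{x^{op}:x\in I\}$. The order $\succ^{op}$ on paths of $Q^{op}$ is defined by $p^{op}\succ^{op}q^{op}$ if and only if $p\succ q$. $KQ$ is the path algebra, $\mathcal B$ the set of all finite directed paths in $Q$ (vertices are paths of length $0$), $\ell(p)$ the length of a path; paths are written left to right, so a path $p$ from $v$ to $w$ satisfies $vpw=p$. ''Ideal'' means two-sided ideal and $\langle X\rangle$ is the two-sided ideal generated by $X$. A length admissible order is a well-order $\succ$ on $\mathcal B$ such that for $p,q,r,s,t\in\mathcal B$: $p\succ q$ implies $pr\succ qr$ if both are nonzero; $p\succ q$ implies $sp\succ sq$ if both are nonzero; $p=rqt$ implies $p\succeq q$; and $\ell(p)>\ell(q)$ implies $p\succ q$. For nonzero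 $x=\sum_{p\in\mathcal B}\alpha_p p\in KQ$, $\mathrm{tip}(x)$ is the $\succ$-largest $p$ with $\alpha_p\neq 0$; for $X\subseteq KQ$, $\mathrm{tip}(X)=\{\mathrm{tip}(x): x\in X, x\ne 0\}$. A nonzero $x$ is uniform if $x=vxw$ for some vertices $v,w$; an element is quadratic if it is a $K$-linear combination of paths of length $2$. An ideal is graded if it is generated by length homogeneous elements. A Gröbner basis of a graded ideal $I$ is a set $\mathcal G\subseteq I$ of length homogeneous uniform elements with $\langle\mathrm{tip}(\mathcal G)\rangle=\langle \mathrm{tip}(I)\rangle$. $KQ/I$ is a strong Koszul algebra (with respect to $I$ and $\succ$) if $I$ is a graded ideal having a Gröbner basis with respect to $\succ$ consisting of quadratic elements; similarly for $KQ^{op}/I^{op}$ with $\succ^{op}$. *)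

(* Defs.v *)
From HB Require Import structures.
From mathcomp Require Import all_boot all_algebra finmap.
From mathcomp Require Import monalg.
From mathcomp Require Import boolp classical_sets wochoice.

Set Implicit Arguments.
Unset Strict Implicit.
Unset Printing Implicit Defensive.

Import GRing.Theory.

Local Open Scope classical_set_scope.
Local Open Scope ring_scope.

Record quiver := Quiver {
  vertex : finType;
  arrow : finType;
  source : arrow -> vertex;
  target : arrow -> vertex }.

(* The arrow a^op of the opposite quiver is represented by a itself. *)
Definition op_quiver (Q : quiver) : quiver :=
  Quiver (@target Q) (@source Q).

Fixpoint walk (Q : quiver) (v : vertex Q) (s : seq (arrow Q)) : bool :=
  if s is a :: s' then (source a == v) && walk (target a) s' else true.

(* A path is its first vertex together with its sequence of arrows, read from
   left to right; (v, [::]) is the path of length 0 at v. *)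
Record qpath (Q : quiver) := QPath {
  qpath_val : vertex Q * seq (arrow Q);
  _ : walk qpath_val.1 qpath_val.2 }.

HB.instance Definition _ Q := [isSub for @qpath_val Q].
HB.instance Definition _ Q := [Choice of qpath Q by <:].

Section Paths.
Variable Q : quiver.
Implicit Types (v : vertex Q) (p q r : qpath Q).

Definition start p : vertex Q := (val p).1.
Definition arrows p : seq (arrow Q) := (val p).2.
Definition finish p : vertex Q := last (start p) (map (@target Q) (arrows p)).
Definition plength p : nat := size (arrows p).

Definition vpath v : qpath Q := QPath (isT : walk (v, [::]).1 (v, [::]).2).

(* None stands for the product 0 of two paths that cannot be concatenated; by
   compose_val below, insub never fails here. *)
Definition compose p q : option (qpath Q) :=
  if finish p == start q then insub (start p, arrows p ++ arrows q) else None.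

Lemma walk_cat v (s t : seq (arrow Q)) :
  walk v (s ++ t) = walk v s && walk (last v (map (@target Q) s)) t.
Proof. by elim: s v => //= a s IHs v; rewrite IHs andbA. Qed.

Lemma compose_val p q : omap val (compose p q) =
  if finish p == start q then Some (start p, arrows p ++ arrows q) else None.
Proof.
rewrite /compose; case: eqP => //= e.
have w : walk (start p) (arrows p ++ arrows q).
  by rewrite walk_cat (valP p) /= -/(finish p) e (valP q).
by rewrite (@insubT _ (fun u : _ * _ => walk u.1 u.2) _ (_, _) w).
Qed.

Lemma op_walk p : walk (Q := op_quiver Q) (finish p) (rev (arrows p)).
Proof.
rewrite /finish /start /arrows; case: p => -[v s] /=.
elim/last_ind: s v => //= s a IHs v.
rewrite -cats1 walk_cat /= andbT => /andP[ws /eqP sa].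
by rewrite rev_cat map_cat last_cat /= eqxx sa IHs.
Qed.

Definition op_path p : qpath (op_quiver Q) :=
  @QPath (op_quiver Q) (finish p, rev (arrows p)) (op_walk p).

End Paths.

(* A K-algebra given by its structure map K -> A, so that k acts as left
   multiplication by alg_map k. The library's algType excludes the zero algebra,
   which can occur as a quotient. *)
Record algebra (K : fieldType) := Algebra {
  alg_ring :> pzRingType;
  alg_map : {rmorphism K -> alg_ring};
  alg_central : forall (k : K) (x : alg_ring), alg_map k * x = x * alg_map k }.

Section Converse.
Variables (K : fieldType) (A : algebra K).

Definition op_map : K -> A^c := @alg_map K A.

Lemma op_map_zmod : zmod_morphism op_map.
Proof. exact: (rmorphB (@alg_map K A)). Qed.

Lemma op_map_monoid : monoid_morphism op_map.
Proof.
split=> [|x y]; first exact: (rmorph1 (@alg_map K A)).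
by rewrite mulrC; exact: (rmorphM (@alg_map K A)).
Qed.

HB.instance Definition _ := GRing.isZmodMorphism.Build K A^c op_map op_map_zmod.
HB.instance Definition _ :=
  GRing.isMonoidMorphism.Build K A^c op_map op_map_monoid.

Definition op_algebra : algebra K :=
  @Algebra K A^c op_map (fun k x => esym (@alg_central K A k x)).

End Converse.

Definition path_alg (K : fieldType) (Q : quiver) : Type := {malg K[qpath Q]}.

HB.instance Definition _ (K : fieldType) Q :=
  GRing.Lmodule.copy (path_alg K Q) {malg K[qpath Q]}.

Section PathAlgebra.
Variables (K : fieldType) (Q : quiver).
Implicit Types (x y z : path_alg K Q) (p q r : qpath Q).

Definition coeff x p : K := mcoeff p x.
Definition supp x : {fset qpath Q} := msupp x.
Definition pbasis p : path_alg K Q := << p >>.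

Definition lin_ext (V : lmodType K) (f : qpath Q -> V) x : V :=
  \sum_(p <- supp x) coeff x p *: f p.

Definition pprod p q : path_alg K Q :=
  if compose p q is Some r then pbasis r else 0.

Definition path_one : path_alg K Q := \sum_(v : vertex Q) pbasis (vpath v).
Definition path_mul x y : path_alg K Q :=
  lin_ext (fun p => lin_ext (fun q => pprod p q) y) x.

Lemma lin_extEw (V : lmodType K) (f : qpath Q -> V) (d : {fset qpath Q}) x :
  (supp x `<=` d)%fset -> lin_ext f x = \sum_(p <- d) coeff x p *: f p.
Proof.
move=> le_d; rewrite /lin_ext; apply: big_fset_incl => // p _ /mcoeff_outdom e.
by rewrite /coeff e scale0r.
Qed.

Lemma lin_ext_linear (V : lmodType K) (f : qpath Q -> V) : linear (lin_ext f).
Proof.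
move=> k x y; pose d := (supp (k *: x + y)%R `|` (supp x `|` supp y))%fset.
rewrite !(@lin_extEw _ f d) ?fsubsetUl //.
- rewrite scaler_sumr -big_split; apply: eq_bigr => p _ /=.
  by rewrite /coeff mcoeffD mcoeffZ scalerDl scalerA.
- by rewrite /d fsubsetU // fsubsetUr orbT.
- by rewrite /d fsubsetU // fsubsetUl orbT.
Qed.

HB.instance Definition _ (V : lmodType K) (f : qpath Q -> V) :=
  GRing.isLinear.Build K (path_alg K Q) V *:%R (lin_ext f) (lin_ext_linear f).

Lemma lin_extU (V : lmodType K) (f : qpath Q -> V) p : lin_ext f (pbasis p) = f p.
Proof.
rewrite (@lin_extEw _ _ [fset p]%fset) ?msuppU_le // big_seq_fset1.
by rewrite /coeff mcoeffUU scale1r.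
Qed.

Lemma lin_ext_basis x : lin_ext pbasis x = x.
Proof.
rewrite [RHS]monalgE /lin_ext; apply: eq_bigr => p _.
apply/malgP => q; rewrite mcoeffZ !mcoeffU /coeff.
by case: eqP; rewrite ?mulr1 ?mulr0.
Qed.

Lemma eq_lin_ext (V : lmodType K) (f g : qpath Q -> V) x : f =1 g -> lin_ext f x = lin_ext g x.
Proof. by move=> e; apply: eq_bigr => p _; rewrite e. Qed.

Lemma lin_ext_comp (V W : lmodType K) (h : {linear V -> W})
    (f : qpath Q -> V) x :
  h (lin_ext f x) = lin_ext (fun p => h (f p)) x.
Proof. by rewrite linear_sum; apply: eq_bigr => p _; rewrite linearZ. Qed.

Definition path_mulr y x := path_mul x y.

Lemma path_mul_linearl y : linear (path_mulr y).
Proof. exact: lin_ext_linear. Qed.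

Lemma path_mul_linearr x : linear (path_mul x).
Proof.
move=> k y z; rewrite /path_mul /lin_ext scaler_sumr -big_split.
apply: eq_bigr => p _ /=; rewrite -!/(lin_ext _ _) linearP scalerDr.
by rewrite !scalerA mulrC.
Qed.

HB.instance Definition _ y := GRing.isLinear.Build K (path_alg K Q)
  (path_alg K Q) *:%R (path_mulr y) (path_mul_linearl y).
HB.instance Definition _ x := GRing.isLinear.Build K (path_alg K Q)
  (path_alg K Q) *:%R (path_mul x) (path_mul_linearr x).

Lemma path_mulUU p q : path_mul (pbasis p) (pbasis q) = pprod p q.
Proof. by rewrite /path_mul !lin_extU. Qed.

Lemma path_ext (V : lmodType K) (f g : {linear path_alg K Q -> V}) :
  (forall p, f (pbasis p) = g (pbasis p)) -> f =1 g.
Proof.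
move=> e x; rewrite -(lin_ext_basis x) !lin_ext_comp.
exact: eq_lin_ext.
Qed.

Lemma compose_assoc p q r :
  obind (compose p) (compose q r) = obind (fun pq => compose pq r) (compose p q).
Proof.
have := compose_val p q; have := compose_val q r.
case: (compose q r) => [qr|]; case: (compose p q) => [pq|] //=.
- case: eqP => // e1 [eqr]; case: eqP => // e2 [epq].
  have [s1 a1] : start qr = start q /\ arrows qr = arrows q ++ arrows r.
    by rewrite /start /arrows /= eqr.
  have [s2 a2] : start pq = start p /\ arrows pq = arrows p ++ arrows q.
    by rewrite /start /arrows /= epq.
  rewrite /compose s1 a1 /finish a2 s2 map_cat last_cat -/(finish p) e2.
  by rewrite -/(finish q) e1 !eqxx catA.
- case: eqP => // e1 [eqr]; case: eqP => // e2 _.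
  rewrite /compose; have -> : start qr = start q by rewrite {1}/start /= eqr.
  by case: eqP.
- case: eqP => // e1 _; case: eqP => // e2 [epq].
  rewrite /compose; have -> : finish pq = finish q; last by case: eqP.
  have [s2 a2] : start pq = start p /\ arrows pq = arrows p ++ arrows q.
    by rewrite /start /arrows /= epq.
  by rewrite /finish s2 a2 map_cat last_cat -/(finish p) e2.
Qed.

Lemma path_mulA : associative path_mul.
Proof.
move=> x y z.
pose L1 := path_mulr (path_mul y z); pose R1 := path_mulr z \o path_mulr y.
apply: (path_ext (f := L1) (g := R1)) => p {L1 R1 x} /=.
pose L2 := path_mul (pbasis p) \o path_mulr z.
pose R2 := path_mulr z \o path_mul (pbasis p).
apply: (path_ext (f := L2) (g := R2)) => q {L2 R2 y} /=.
pose L3 := path_mul (pbasis p) \o path_mul (pbasis q).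
pose R3 := path_mul (path_mul (pbasis p) (pbasis q)).
apply: (path_ext (f := L3) (g := R3)) => r {L3 R3 z} /=.
have := compose_assoc p q r; rewrite !path_mulUU /pprod.
case: (compose q r) => [qr|]; case: (compose p q) => [pq|] /=;
  rewrite ?linear0 ?path_mulUU /pprod => e.
- by rewrite e.
- by rewrite e; exact/esym/(linear0 (path_mulr _)).
- by rewrite -e.
- exact/esym/(linear0 (path_mulr _)).
Qed.

Lemma compose_vl v p :
  compose (vpath v) p = if v == start p then Some p else None.
Proof.
have := compose_val (vpath v) p; rewrite (_ : finish (vpath v) = v) //.
case: eqP => [->|_]; case: compose => //= q [e]; congr Some; apply: val_inj.
by rewrite /= e [RHS]surjective_pairing.
Qed.

Lemma compose_vr v p :
  compose p (vpath v) = if v == finish p then Some p else None.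
Proof.
have := compose_val p (vpath v); rewrite (_ : start (vpath v) = v) // eq_sym.
case: eqP => [->|_]; case: compose => //= q [e]; congr Some; apply: val_inj.
by rewrite /= e cats0 [RHS]surjective_pairing.
Qed.

Lemma path_mul1l : left_id path_one path_mul.
Proof.
apply: (path_ext (f := path_mul path_one) (g := idfun)) => p /=.
rewrite -/(path_mulr _ _) /path_one linear_sum (bigD1 (start p)) //=.
rewrite {1}/path_mulr path_mulUU /pprod compose_vl eqxx big1 ?addr0 // => v /negPf nv.
by rewrite /path_mulr path_mulUU /pprod compose_vl nv.
Qed.

Lemma path_mul1r : right_id path_one path_mul.
Proof.
apply: (path_ext (f := path_mulr path_one) (g := idfun)) => p /=.
rewrite /path_mulr /path_one linear_sum (bigD1 (finish p)) //= path_mulUU.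
rewrite /pprod compose_vr eqxx big1 ?addr0 // => v /negPf nv.
by rewrite path_mulUU /pprod compose_vr nv.
Qed.

Lemma path_mulDl : left_distributive path_mul +%R.
Proof. by move=> x y z; exact: (linearD (path_mulr z)). Qed.

Lemma path_mulDr : right_distributive path_mul +%R.
Proof. by move=> x y z; exact: linearD. Qed.

HB.instance Definition _ := GRing.Zmodule_isPzRing.Build (path_alg K Q)
  path_mulA path_mul1l path_mul1r path_mulDl path_mulDr.

Lemma path_scaleAl k x y : k *: (x * y) = (k *: x) * y.
Proof. exact/esym/(linearZ_LR (path_mulr y)). Qed.

Lemma path_scaleAr k x y : k *: (x * y) = x * (k *: y).
Proof. exact/esym/(linearZ_LR (path_mul x)). Qed.

End PathAlgebra.

Section Ideals.
Variable A : pzRingType.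

Definition two_sided_ideal (I : set A) : Prop :=
  [/\ I 0, (forall x y, I x -> I y -> I (x + y))
    & forall a x b, I x -> I (a * x * b)].

Definition ideal_gen (X : set A) : set A := smallest two_sided_ideal X.

End Ideals.

(* L is the K-algebra KQ/I, up to isomorphism. *)
Definition is_quotient (K : fieldType) (Q : quiver) (I : set (path_alg K Q))
    (L : algebra K) : Prop :=
  exists pi : {rmorphism path_alg K Q -> L},
    [/\ (forall k x, pi (k *: x) = alg_map L k * pi x),
        (forall y, exists x, pi x = y)
      & forall x, I x <-> pi x = 0].

Section LengthAdmissible.
Variable Q : quiver.

(* gt p q is the strict relation p > q. *)
Definition length_admissible (gt : rel (qpath Q)) : Prop :=
  [/\ irreflexive gt /\ well_order (fun p q => (p == q) || gt q p),
      (forall p q r pr qr, compose p r = Some pr -> compose q r = Some qr ->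
         gt p q -> gt pr qr),
      (forall p q s sp sq, compose s p = Some sp -> compose s q = Some sq ->
         gt p q -> gt sp sq),
      (forall p q r t rq, compose r q = Some rq -> compose rq t = Some p ->
         (p == q) || gt p q)
    & forall p q, (plength p > plength q)%N -> gt p q].

End LengthAdmissible.

Section StrongKoszul.
Variables (K : fieldType) (Q : quiver).
Implicit Types (x : path_alg K Q) (p q : qpath Q) (X G I : set (path_alg K Q)).

(* For x nonzero and gt a well-order, tip(x) is the unique p with is_tip gt x p. *)
Definition is_tip (gt : rel (qpath Q)) x p : Prop :=
  p \in supp x /\ forall q, q \in supp x -> q != p -> gt p q.

(* tip(X), each path being seen as an element of the path algebra *)
Definition tip (gt : rel (qpath Q)) X : set (path_alg K Q) :=
  [set t | exists x p, [/\ X x, x != 0, is_tip gt x p & t = pbasis K p]].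

Definition length_homogeneous x : Prop :=
  exists n, forall p, p \in supp x -> plength p = n.

Definition uniform x : Prop :=
  x != 0 /\
  exists v w : vertex Q, x = pbasis K (vpath v) * x * pbasis K (vpath w).

Definition quadratic x : Prop := forall p, p \in supp x -> plength p = 2.

Definition graded_ideal I : Prop :=
  exists2 X, X `<=` length_homogeneous & I = ideal_gen X.

Definition groebner_basis (gt : rel (qpath Q)) I G : Prop :=
  [/\ G `<=` I, G `<=` length_homogeneous, G `<=` uniform
    & ideal_gen (tip gt G) = ideal_gen (tip gt I)].

(* L, which is KQ/I, is a strong Koszul algebra with respect to I and gt. *)
Definition strong_koszul (L : algebra K) (I : set (path_alg K Q))
    (gt : rel (qpath Q)) : Prop :=
  [/\ is_quotient I L, length_admissible gt, graded_ideal I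
    & exists2 G, groebner_basis gt I G & G `<=` quadratic].

End StrongKoszul.

Section Opposite.
Variables (K : fieldType) (Q : quiver).

Definition op_elt : path_alg K Q -> path_alg K (op_quiver Q) :=
  lin_ext (fun p => pbasis K (op_path p)).

Definition op_ideal (I : set (path_alg K Q)) : set (path_alg K (op_quiver Q)) :=
  op_elt @` I.

Definition op_order (gt : rel (qpath Q)) : rel (qpath (op_quiver Q)) :=
  fun p' q' =>
    `[< exists p q, [/\ p' = op_path p, q' = op_path q & gt p q] >].

End Opposite.

(* Main.v *)
From HB Require Import structures.
Require Import Defs.
From mathcomp Require Import all_boot all_algebra classical_sets.
From mathcomp Require Import finmap monalg boolp wochoice.

Set Implicit Arguments.
Unset Strict Implicit.
Unset Printing Implicit Defensive.

Import GRing.Theory.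

Local Open Scope classical_set_scope.
Local Open Scope ring_scope.

(** Reversal of paths is a length-preserving bijection from the paths of [Q]
    onto those of [Q^op] which exchanges the two factors of a concatenation
    ([op_path], [compose_op]). Extended linearly it becomes a bijective
    antihomomorphism [KQ -> KQ^op] ([op_eltM]) which moves coefficients along
    the bijection of paths ([coeff_op]). The notions entering the definition of a
    strong Koszul algebra are either insensitive to the order of multiplication
    or symmetric under it, so all of them are carried along:

    - the axioms of a length admissible order come in left/right pairs that are
      exchanged by reversal ([length_admissible_op]);
    - an antihomomorphism pulls two-sided ideals back to two-sided ideals, hence
      a bijective one commutes with the formation of generated ideals
      ([ideal_gen_anti]);
    - supports correspond and the order is transported, so tips correspond
      ([tip_op]); so do homogeneous, quadratic and uniform elements, the last
      with the two idempotents exchanged ([uniform_op]).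

    Consequently [G] is a quadratic Groebner basis of [I] if and only if its
    image is one of [I^op] ([groebner_basis_op]), and as every subset of [KQ^op]
    is an image, both directions of the theorem follow. The conditions that the
    algebra is the quotient and that the order is admissible are hypotheses on
    the side of [Q], so they are transported in one direction only. *)

(** * Reversal of paths *)

Section OpPath.
Variable Q : quiver.
Implicit Types (p q r : qpath Q).

(** Once the record [Q] is split into its fields, the opposite of its opposite
    is convertible to [Q], so this is [op_walk] for the opposite quiver. *)
Lemma unop_walk (p' : qpath (op_quiver Q)) :
  walk (Q := Q) (finish p') (rev (arrows p')).
Proof. by case: Q p' => V A s t p'; exact: (op_walk p'). Qed.

(** The inverse of [op_path], defined directly because [op_path] on [op_quiver Q]
    takes values in the paths of [op_quiver (op_quiver Q)], a quiver that is not
    convertible to [Q] when [Q] is a variable. *)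
Definition unop_path (p' : qpath (op_quiver Q)) : qpath Q :=
  @QPath Q (finish p', rev (arrows p')) (unop_walk p').

Lemma finish_op_path p : finish (op_path p) = start p.
Proof.
have := valP p; rewrite /finish -[arrows (op_path p)]/(rev (arrows p)).
rewrite -[(val p).2]/(arrows p) -[(val p).1]/(start p).
rewrite -[start (op_path p)]/(finish p) /finish.
case: (arrows p) => [|a s] //= /andP[/eqP <- _].
by rewrite rev_cons map_rcons last_rcons.
Qed.

Lemma finish_unop_path (p' : qpath (op_quiver Q)) :
  finish (unop_path p') = start p'.
Proof.
have := valP p'; rewrite /finish -[arrows (unop_path p')]/(rev (arrows p')).
rewrite -[(val p').2]/(arrows p') -[(val p').1]/(start p').
rewrite -[start (unop_path p')]/(finish p') /finish.
case: (arrows p') => [|a s] //= /andP[/eqP <- _].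
by rewrite rev_cons map_rcons last_rcons.
Qed.

Lemma op_pathK : cancel (@op_path Q) unop_path.
Proof.
move=> p; apply: val_inj.
by rewrite /= finish_op_path revK [RHS]surjective_pairing.
Qed.

Lemma unop_pathK : cancel unop_path (@op_path Q).
Proof.
move=> p'; apply: val_inj.
by rewrite /= finish_unop_path revK [RHS]surjective_pairing.
Qed.

Lemma op_path_inj : injective (@op_path Q).
Proof. exact: can_inj op_pathK. Qed.

(** The two sides are undefined together, since [finish p = start q] says that
    [p^op] starts where [q^op] ends. *)
Lemma compose_op p q :
  compose (op_path q) (op_path p) = omap (@op_path Q) (compose p q).
Proof.
apply: (inj_omap val_inj); rewrite compose_val finish_op_path eq_sym.
have := compose_val p q; rewrite -[start (op_path p)]/(finish p).
case: (compose p q) => [r|] /=; case: eqP => //= e [val_r].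
have [sr ar] : start r = start p /\ arrows r = arrows p ++ arrows q.
  by rewrite /start /arrows /= val_r.
rewrite -[start (op_path q)]/(finish q) -rev_cat -ar; congr (Some (_, _)).
by rewrite /finish sr ar map_cat last_cat -/(finish p) e.
Qed.

Lemma compose_unop (p' q' r' : qpath (op_quiver Q)) :
  compose p' q' = Some r' ->
  compose (unop_path q') (unop_path p') = Some (unop_path r').
Proof.
rewrite -{1}[p']unop_pathK -{1}[q']unop_pathK compose_op.
by case: compose => //= r [<-]; rewrite op_pathK.
Qed.

Lemma op_vpath (v : vertex Q) : op_path (vpath v) = vpath (Q := op_quiver Q) v.
Proof. exact: val_inj. Qed.

Lemma plength_op_path p : plength (op_path p) = plength p.
Proof. exact: size_rev. Qed.

Lemma plength_unop_path (p' : qpath (op_quiver Q)) :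
  plength (unop_path p') = plength p'.
Proof. exact: size_rev. Qed.

End OpPath.

(** * The opposite of a length admissible order *)

Lemma well_order_preim (S T : Type) (g : T -> S) (f : S -> T) (R : rel S) :
  cancel f g -> cancel g f -> well_order R ->
  well_order (fun x y => R (g x) (g y)).
Proof.
move=> fK gK woR A [x Ax].
have [|z [[Az lbz] uz]] := woR [pred s | f s \in A].
  by exists (g x); rewrite inE gK.
exists (f z); split=> [|y [Ay lby]].
  by split=> // y Ay; rewrite fK; apply: lbz; rewrite inE gK.
rewrite -[y]gK; congr f; apply: uz; split; first by rewrite inE gK.
by move=> s; rewrite inE => /lby; rewrite fK.
Qed.

Section OpOrder.
Variables (Q : quiver) (gt : rel (qpath Q)).

(** Comparing through [unop_path] removes the existential quantifiers from the
    definition, as the preimages of two opposite paths are unique. *)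
Lemma op_orderE : op_order gt = fun p' q' => gt (unop_path p') (unop_path q').
Proof.
apply/funext => p'; apply/funext => q'; apply/asboolP/idP.
  by move=> [p [q [-> -> ]]]; rewrite !op_pathK.
by move=> g; exists (unop_path p'), (unop_path q'); rewrite !unop_pathK.
Qed.

Lemma op_order_op p q : op_order gt (op_path p) (op_path q) = gt p q.
Proof. by rewrite op_orderE !op_pathK. Qed.

(** Compatibility with right multiplication for the opposite order is
    compatibility with left multiplication for [gt], and conversely. *)
Lemma length_admissible_op :
  length_admissible gt -> length_admissible (op_order gt).
Proof.
move=> [[irr wo] mulr mull sub len].
have unop_inj := can_inj (@unop_pathK Q).
rewrite op_orderE; split.
- split=> [p'|]; first exact: irr.
  rewrite (_ : (fun p' q' => _) = fun p' q' =>
    (fun p q => (p == q) || gt q p) (unop_path p') (unop_path q')).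
    exact: (well_order_preim (@op_pathK Q) (@unop_pathK Q) wo).
  by apply/funext => p'; apply/funext => q'; rewrite (inj_eq unop_inj).
- by move=> p q r pr qr /compose_unop + /compose_unop; exact: mull.
- by move=> p q s sp sq /compose_unop + /compose_unop; exact: mulr.
- move=> p q r t rq /compose_unop qr /compose_unop trq.
  (* Here [p = (r q) t], read backwards, is [p = t (q r)], whereas the subpath
     axiom for [gt] expects the bracketing [(t q) r]. *)
  have := compose_assoc (unop_path t) (unop_path q) (unop_path r).
  rewrite qr /= trq; case tq : compose => [tq'|] //= tqr.
  by rewrite -(inj_eq unop_inj); exact: (sub _ _ _ _ _ tq (esym tqr)).
- by move=> p q; rewrite -!plength_unop_path; exact: len.
Qed.

End OpOrder.

(** * Ideals under an antiautomorphism *)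

Section AntiMorphism.
Variables (A B : pzRingType) (f : {additive A -> B}).
Hypothesis fM : forall x y, f (x * y) = f y * f x.

(** The factors [a] and [b] of [a x b] are exchanged by [f], which a two-sided
    ideal does not notice. *)
Lemma preimage_ideal (J : set B) :
  two_sided_ideal J -> two_sided_ideal (f @^-1` J).
Proof.
case=> J0 JD JM; split=> [|x y|a x b] /=; first by rewrite raddf0.
  by rewrite raddfD; exact: JD.
by rewrite !fM mulrA; exact: JM.
Qed.

(** The preimage of any ideal containing the image of [X] is an ideal containing
    [X]. *)
Lemma ideal_gen_anti_sub (X : set A) : f @` ideal_gen X `<=` ideal_gen (f @` X).
Proof.
move=> _ [x Ix <-] J [idJ sJ]; apply: (Ix (f @^-1` J)).
by split; [exact: preimage_ideal | move=> z Xz; apply: sJ; exists z].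
Qed.

End AntiMorphism.

(** One inclusion is [ideal_gen_anti_sub] for [f], the other is the same lemma
    for the inverse of [f]. *)
Lemma ideal_gen_anti (A B : pzRingType) (f : {additive A -> B})
    (g : {additive B -> A}) (X : set A) :
  cancel f g -> cancel g f -> (forall x y, f (x * y) = f y * f x) ->
  ideal_gen (f @` X) = f @` ideal_gen X.
Proof.
move=> fK gK fM; apply/seteqP; split; last exact: ideal_gen_anti_sub.
have gM x y : g (x * y) = g y * g x.
  by apply: (can_inj fK); rewrite fM !gK.
move=> y Iy; exists (g y); last exact: gK.
have /(ideal_gen_anti_sub gM) : (g @` ideal_gen (f @` X)) (g y) by exists y.
by rewrite image_comp (_ : g \o f = id) ?image_id //; apply/funext.
Qed.

(** * Reversal of elements of the path algebra *)

Section OpElt.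
Variables (K : fieldType) (Q : quiver).
Local Notation op := (@op_elt K Q).
Implicit Types (x y : path_alg K Q) (X G I : set (path_alg K Q)).

Definition unop_elt : path_alg K (op_quiver Q) -> path_alg K Q :=
  lin_ext (fun p' => pbasis K (unop_path p')).

HB.instance Definition _ := GRing.Linear.on op.
HB.instance Definition _ := GRing.Linear.on unop_elt.

Lemma op_eltU p : op (pbasis K p) = pbasis K (op_path p).
Proof. exact: lin_extU. Qed.

Lemma unop_eltU p' : unop_elt (pbasis K p') = pbasis K (unop_path p').
Proof. exact: lin_extU. Qed.

Lemma op_eltK : cancel op unop_elt.
Proof.
apply: (path_ext (f := unop_elt \o op) (g := idfun)) => p /=.
by rewrite op_eltU unop_eltU op_pathK.
Qed.

Lemma unop_eltK : cancel unop_elt op.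
Proof.
apply: (path_ext (f := op \o unop_elt) (g := idfun)) => p /=.
by rewrite unop_eltU op_eltU unop_pathK.
Qed.

Lemma op_elt_inj : injective op.
Proof. exact: can_inj op_eltK. Qed.

Lemma op_elt_eq0 x : (op x == 0) = (x == 0).
Proof. by rewrite -(inj_eq op_elt_inj) linear0. Qed.

(** Both sides are bilinear, so the identity is checked on paths, where it is
    [compose_op]. *)
Lemma op_eltM x y : op (x * y) = op y * op x.
Proof.
pose L1 := op \o path_mulr y; pose R1 := path_mul (op y) \o op.
apply: (path_ext (f := L1) (g := R1)) => p {L1 R1 x} /=.
pose L2 := op \o path_mul (pbasis K p).
pose R2 := path_mulr (op (pbasis K p)) \o op.
apply: (path_ext (f := L2) (g := R2)) => q {L2 R2 y} /=.
rewrite /path_mulr path_mulUU !op_eltU path_mulUU /pprod compose_op.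
by case: compose => [r|] /=; [exact: op_eltU | exact: linear0].
Qed.

Lemma op_elt1 : op 1 = 1.
Proof.
rewrite -[LHS]/(op (path_one K Q)) /path_one linear_sum.
by apply: eq_bigr => v _; rewrite /= op_eltU op_vpath.
Qed.

(** Since [op_path] is injective, no two terms of [x] are merged. *)
Lemma coeff_op x p : coeff (op x) (op_path p) = coeff x p.
Proof.
rewrite -[in RHS](lin_ext_basis x) /op_elt /lin_ext /coeff !raddf_sum.
apply: eq_bigr => q _ /=.
by rewrite !mcoeffZ !mcoeffU (inj_eq (@op_path_inj Q)).
Qed.

Lemma supp_op x p : (op_path p \in supp (op x)) = (p \in supp x).
Proof. by rewrite -!mcoeff_neq0 -!/(coeff _ _) coeff_op. Qed.

Lemma forall_supp_op x (P : qpath (op_quiver Q) -> Prop) :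
  (forall p', p' \in supp (op x) -> P p') <->
  (forall p, p \in supp x -> P (op_path p)).
Proof.
split=> sP p; first by rewrite -supp_op; exact: sP.
by rewrite -[p]unop_pathK supp_op; exact: sP.
Qed.

Lemma length_homogeneous_op x :
  length_homogeneous (op x) <-> length_homogeneous x.
Proof.
by split=> -[n hn]; exists n; [move=> p ps | apply/forall_supp_op => p ps];
  [rewrite -plength_op_path | rewrite plength_op_path];
  apply: hn; rewrite ?supp_op.
Qed.

Lemma quadratic_op x : quadratic (op x) <-> quadratic x.
Proof.
rewrite /quadratic forall_supp_op.
by split=> h p /h; rewrite plength_op_path.
Qed.

(** [x = v x w] reads [x^op = w x^op v] in the opposite algebra: the two vertices
    change roles. *)
Lemma uniform_op x : uniform (op x) <-> uniform x.
Proof.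
have corner v w : op (pbasis K (vpath w) * x * pbasis K (vpath v)) =
    pbasis K (vpath (Q := op_quiver Q) v) * op x *
    pbasis K (vpath (Q := op_quiver Q) w).
  by rewrite !op_eltM !op_eltU !op_vpath mulrA.
rewrite /uniform op_elt_eq0; split=> -[x0 [v [w e]]]; split=> //; exists w, v.
  by apply: op_elt_inj; rewrite corner.
by rewrite -corner -e.
Qed.

Lemma ideal_gen_op X : ideal_gen (op @` X) = op_ideal (ideal_gen X).
Proof. exact: ideal_gen_anti op_eltK unop_eltK op_eltM. Qed.

Lemma image_op_inj : injective (fun X => op @` X).
Proof.
move=> X Y /= e; apply/seteqP; split=> x.
  move=> Xx; have : (op @` X) (op x) by exists x.
  by rewrite e => -[y Yy /op_elt_inj <-].
move=> Yx; have : (op @` Y) (op x) by exists x.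
by rewrite -e => -[y Xy /op_elt_inj <-].
Qed.

Lemma image_op_surj (Y : set (path_alg K (op_quiver Q))) :
  exists X, Y = op @` X.
Proof.
exists (op @^-1` Y); apply/seteqP; split=> [y Yy|_ [x Yx <-]] //.
by exists (unop_elt y); rewrite /= unop_eltK.
Qed.

Lemma image_op_sub X (P : set (path_alg K Q)) P' :
  (forall x, P' (op x) <-> P x) -> (op @` X `<=` P' <-> X `<=` P).
Proof.
move=> PP'; split=> [s x Xx | s _ [x Xx <-]]; apply/PP'; last exact: s.
by apply: s; exists x.
Qed.

(** For the direct implication, homogeneous generators of [I^op] are the image of
    a set of homogeneous elements of [KQ]; the ideals generated on the two sides
    correspond, so by injectivity the latter generates [I]. *)
Lemma graded_ideal_op I : graded_ideal (op_ideal I) <-> graded_ideal I.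
Proof.
split=> -[X hX e].
  have [Y eY] := image_op_surj X; rewrite eY in hX e.
  exists Y; first by move: hX; rewrite (image_op_sub _ length_homogeneous_op).
  by apply: image_op_inj; rewrite -[RHS]ideal_gen_op.
exists (op @` X); first exact/(image_op_sub _ length_homogeneous_op).
by rewrite ideal_gen_op -e.
Qed.

(** * Tips and Groebner bases *)

Variable gt : rel (qpath Q).

Lemma is_tip_op x p :
  is_tip (op_order gt) (op x) (op_path p) <-> is_tip gt x p.
Proof.
rewrite /is_tip supp_op forall_supp_op.
by split=> -[ps h]; split=> // q /h;
  rewrite (inj_eq (@op_path_inj Q)) op_order_op.
Qed.

(** The maximum of the support is transported because both the support and the
    order are. *)
Lemma tip_op X : tip (op_order gt) (op @` X) = op @` tip gt X.
Proof.
apply/seteqP; split.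
  move=> _ [_ [p' [[x Xx <-] x0 + ->]]].
  rewrite -[p']unop_pathK is_tip_op => tx; rewrite -op_eltU.
  exists (pbasis K (unop_path p')) => //; exists x, (unop_path p').
  by split=> //; move: x0; rewrite op_elt_eq0.
move=> _ [_ [x [p [Xx x0 tx ->]]] <-]; exists (op x), (op_path p); split.
- by exists x.
- by rewrite op_elt_eq0.
- exact/is_tip_op.
- exact: op_eltU.
Qed.

(** The equality of the two ideals generated by tips is reflected as well as
    preserved, taking images of subsets being injective. *)
Lemma groebner_basis_op I G :
  groebner_basis (op_order gt) (op_ideal I) (op @` G) <-> groebner_basis gt I G.
Proof.
have subI x : op_ideal I (op x) <-> I x.
  by split=> [[y Iy /op_elt_inj <-]|Ix] //; exists x.
have tips : ideal_gen (tip (op_order gt) (op @` G)) =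
    ideal_gen (tip (op_order gt) (op_ideal I)) <->
    ideal_gen (tip gt G) = ideal_gen (tip gt I).
  rewrite !tip_op !ideal_gen_op.
  by split=> [/image_op_inj|->].
split=> -[h1 h2 h3 h4]; split.
- by move: h1; rewrite (image_op_sub _ subI).
- by move: h2; rewrite (image_op_sub _ length_homogeneous_op).
- by move: h3; rewrite (image_op_sub _ uniform_op).
- exact/tips.
- exact/(image_op_sub _ subI).
- exact/(image_op_sub _ length_homogeneous_op).
- exact/(image_op_sub _ uniform_op).
- exact/tips.
Qed.

Lemma quadratic_groebner_basis_op I :
  (exists2 G, groebner_basis (op_order gt) (op_ideal I) G
     & G `<=` @quadratic K (op_quiver Q)) <->
  (exists2 G, groebner_basis gt I G & G `<=` @quadratic K Q).
Proof.
split=> -[G bG qG]; last first.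
  exists (op @` G); first exact/groebner_basis_op.
  exact/(image_op_sub _ quadratic_op).
have [H eG] := image_op_surj G; rewrite eG in bG qG.
exists H; first exact/groebner_basis_op.
exact/(image_op_sub _ quadratic_op).
Qed.

End OpElt.

(** * The opposite of a quotient of the path algebra *)

Section Quotient.
Variables (K : fieldType) (Q : quiver) (L : algebra K).
Variable pi : {rmorphism path_alg K Q -> L}.

(** Reversal and the change of multiplication from [L] to its converse are both
    multiplication-reversing, so their combination with [pi] is a homomorphism. *)
Definition op_quotient_map (y : path_alg K (op_quiver Q)) : op_algebra L :=
  pi (unop_elt y).

Lemma op_quotient_map_zmod : zmod_morphism op_quotient_map.
Proof. by move=> x y; rewrite /op_quotient_map !raddfB. Qed.

Lemma op_quotient_map_monoid : monoid_morphism op_quotient_map.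
Proof.
split=> [|x y]; rewrite /op_quotient_map.
  by rewrite -op_elt1 op_eltK rmorph1.
by rewrite -{1}[x]unop_eltK -{1}[y]unop_eltK -op_eltM op_eltK rmorphM.
Qed.

HB.instance Definition _ := GRing.isZmodMorphism.Build _ _ op_quotient_map
  op_quotient_map_zmod.
HB.instance Definition _ := GRing.isMonoidMorphism.Build _ _ op_quotient_map
  op_quotient_map_monoid.

Definition op_quotient : {rmorphism path_alg K (op_quiver Q) -> op_algebra L} :=
  op_quotient_map.

End Quotient.

Lemma is_quotient_op (K : fieldType) (Q : quiver) (I : set (path_alg K Q))
    (L : algebra K) :
  is_quotient I L -> is_quotient (op_ideal I) (op_algebra L).
Proof.
case=> pi [piZ pi_surj kerpi]; exists (op_quotient pi); split.
- move=> k x; rewrite /= /op_quotient_map linearZ piZ.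
  exact: alg_central.
- move=> y; have [x <-] := pi_surj y; exists (op_elt x).
  by rewrite /= /op_quotient_map op_eltK.
- move=> y; rewrite /= /op_quotient_map -kerpi; split=> [[x Ix <-]|Iy].
    by rewrite op_eltK.
  by exists (unop_elt y); rewrite ?unop_eltK.
Qed.

Theorem proposition7p1 (K : fieldType) (Q : quiver) (gt : rel (qpath Q))
    (I : set (path_alg K Q)) (L : algebra K) :
  length_admissible gt -> two_sided_ideal I -> is_quotient I L ->
  (strong_koszul L I gt <->
   strong_koszul (op_algebra L) (op_ideal I) (op_order gt)).
Proof.
move=> gt_adm _ quot; have := quadratic_groebner_basis_op gt I.
have := graded_ideal_op I; rewrite /strong_koszul => gr gb.
split=> -[_ _ /gr ? /gb ?]; split=> //.
- exact: is_quotient_op.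
- exact: length_admissible_op.
Qed.
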